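(* The problem Independent Set$_{\ell}$ has no solution-preserving DP-core of table-complexity $2^{o(k/\log k)}\cdot n^{O(1)}$ on $n$-vertex graphs of treewidth at most $k$.
   Context: Independent Set$_\ell$ is the vertex subset problem of all pairs $(G,X)$ with $X$ an independent set of size at least $\ell$ in $G$. A DP-core is a specification of a dynamic programming algorithm over nice edge-introducing tree decompositions, given by a finite set of leaf strings and functions IntroVertex, IntroEdge, ForgetVertex, Join (mapping strings to finite sets of strings) and a Final predicate; processing a decomposition bottom-up assigns to each node $u$ a set $\Gamma(u)$ of strings, and the decomposition is accepted iff the root set contains a final string. The DP-core solves $\Pi$ if it accepts a tree decomposition of $G$ iff $G$ has a solution. It has table complexity $\alpha(k,n)$ if $|\Gamma(u)|\le\alpha(k,n)$ for every node of every width-$\le k$ decomposition of every $n$-vertex graph. A witness tree assigns to each node a string consistent with the DP-core's operations and with a final string at the root. The DP-core is solution-preserving if there is a membership function $\mu:\mathbb{N}\times\{0,1\}^*\to\{0,1\}$ such that, extracting from a witness tree $W$ the set of vertices $v$ with $\mu(v,W(u_v))=1$ (where $u_v$ is the child of the node where $v$ is forgotten), every witness tree yields a solution, and every solution is obtained from some witness tree. *)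

(* Defs.v *)
From mathcomp Require Import all_boot all_order all_algebra finmap.
From mathcomp Require Import boolp classical_sets reals ereal topology.
From mathcomp Require Import normedtype sequences landau exp.
Import numFieldNormedType.Exports.

Set Implicit Arguments.
Unset Strict Implicit.
Unset Printing Implicit Defensive.

Local Open Scope fset_scope.

(* Finite simple graphs whose vertices are natural numbers: DP-cores and
   membership functions receive the vertices themselves as arguments. *)
Record sgraph := SGraph {
  vertices : {fset nat};
  edges : {fset {fset nat}};
  edgesP : forall e, e \in edges -> (e `<=` vertices) && (#|` e| == 2)
}.

Definition vertex_subset_problem := sgraph -> {fset nat} -> Prop.

Definition independent (G : sgraph) (X : {fset nat}) : Prop :=
  X `<=` vertices G /\
  forall u v, u \in X -> v \in X -> [fset u; v] \notin edges G.

Definition IndependentSet (l : nat) : vertex_subset_problem :=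
  fun G X => independent G X /\ l <= #|` X|.

(* Underlying labelled rooted tree of a nice edge-introducing decomposition.
   Since leaf bags are empty, the labels determine all bags. *)
Inductive ntree :=
  | Leaf
  | IntroVertex of nat & ntree
  | IntroEdge of {fset nat} & ntree
  | ForgetVertex of nat & ntree
  | Join of ntree & ntree.

Fixpoint bag (t : ntree) : {fset nat} :=
  match t with
  | Leaf => fset0
  | IntroVertex v t' => v |` bag t'
  | IntroEdge _ t' => bag t'
  | ForgetVertex v t' => bag t' `\ v
  | Join t1 _ => bag t1
  end.

Fixpoint nice (t : ntree) : bool :=
  match t with
  | Leaf => true
  | IntroVertex v t' => (v \notin bag t') && nice t'
  | IntroEdge e t' => (e `<=` bag t') && nice t'
  | ForgetVertex v t' => (v \in bag t') && nice t'
  | Join t1 t2 => [&& bag t1 == bag t2, nice t1 & nice t2]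
  end.

Fixpoint introduced_edges (t : ntree) : seq {fset nat} :=
  match t with
  | Leaf => [::]
  | IntroVertex _ t' | ForgetVertex _ t' => introduced_edges t'
  | IntroEdge e t' => e :: introduced_edges t'
  | Join t1 t2 => introduced_edges t1 ++ introduced_edges t2
  end.

(* A node is the word spelling the path from the root: [false] leads to the
   only, or to the left, child and [true] to the right child. *)
Definition node := seq bool.

Definition lchild (u : node) : node := rcons u false.
Definition rchild (u : node) : node := rcons u true.

Fixpoint nodes (t : ntree) : seq node :=
  [::] ::
  match t with
  | Leaf => [::]
  | IntroVertex _ t' | IntroEdge _ t' | ForgetVertex _ t' =>
      [seq false :: u | u <- nodes t']
  | Join t1 t2 =>
      [seq false :: u | u <- nodes t1] ++ [seq true :: u | u <- nodes t2]
  end.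

(* Only meaningful when [u \in nodes t]; the default value is [Leaf]. *)
Fixpoint subtree (t : ntree) (u : node) : ntree :=
  match u, t with
  | [::], _ => t
  | false :: u', (IntroVertex _ t' | IntroEdge _ t' | ForgetVertex _ t') =>
      subtree t' u'
  | false :: u', Join t1 _ => subtree t1 u'
  | true :: u', Join _ t2 => subtree t2 u'
  | _, _ => Leaf
  end.

Definition bag_at (t : ntree) (u : node) : {fset nat} := bag (subtree t u).

Definition is_parent (u w : node) : bool := (w == lchild u) || (w == rchild u).

Definition tree_adj (u w : node) : bool := is_parent u w || is_parent w u.

Definition tree_decomposition (G : sgraph) (t : ntree) : Prop :=
  [/\ forall v, v \in vertices G <-> exists2 u, u \in nodes t & v \in bag_at t u,
      forall e, e \in edges G -> exists2 u, u \in nodes t & e `<=` bag_at t u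
    & (* the nodes whose bag contains [v] induce a connected subtree *)
      forall v u w,
        u \in nodes t -> w \in nodes t -> v \in bag_at t u -> v \in bag_at t w ->
        exists p : seq node,
          [/\ path tree_adj u p, last u p = w
            & forall x, x \in p -> x \in nodes t /\ v \in bag_at t x]].

(* Nice tree decomposition with empty root bag, in which every edge of the
   graph, and nothing else, is introduced exactly once. *)
Definition nice_tree_decomposition (G : sgraph) (t : ntree) : Prop :=
  [/\ tree_decomposition G t, nice t, bag t = fset0
    & forall e, count_mem e (introduced_edges t) = (e \in edges G)].

Definition width (t : ntree) : nat := (\max_(u <- nodes t) #|` bag_at t u|).-1.

Definition bitstring := seq bool.

Record dp_core := DPCore {
  leaf : {fset bitstring};
  intro_vertex : nat -> bitstring -> {fset bitstring};
  intro_edge : {fset nat} -> bitstring -> {fset bitstring};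
  forget_vertex : nat -> bitstring -> {fset bitstring};
  join : bitstring -> bitstring -> {fset bitstring};
  final : pred bitstring
}.

Fixpoint Gamma (D : dp_core) (t : ntree) : {fset bitstring} :=
  match t with
  | Leaf => leaf D
  | IntroVertex v t' => \bigcup_(s <- Gamma D t') intro_vertex D v s
  | IntroEdge e t' => \bigcup_(s <- Gamma D t') intro_edge D e s
  | ForgetVertex v t' => \bigcup_(s <- Gamma D t') forget_vertex D v s
  | Join t1 t2 =>
      \bigcup_(s1 <- Gamma D t1) \bigcup_(s2 <- Gamma D t2) join D s1 s2
  end.

Definition Gamma_at (D : dp_core) (t : ntree) (u : node) : {fset bitstring} :=
  Gamma D (subtree t u).

Definition accepts (D : dp_core) (t : ntree) : Prop :=
  exists2 s, s \in Gamma D t & final D s.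

Definition solves (D : dp_core) (Pi : vertex_subset_problem) : Prop :=
  forall G t, nice_tree_decomposition G t ->
    accepts D t <-> exists X, Pi G X.

Definition table_complexity (D : dp_core) (alpha : nat -> nat -> nat) : Prop :=
  forall k n G t, #|` vertices G| = n -> nice_tree_decomposition G t ->
    width t <= k -> forall u, u \in nodes t -> #|` Gamma_at D t u| <= alpha k n.

(* The values of [W] outside [nodes t] are irrelevant. *)
Definition witness_tree (D : dp_core) (t : ntree) (W : node -> bitstring) : Prop :=
  (forall u, u \in nodes t ->
     match subtree t u with
     | Leaf => W u \in leaf D
     | IntroVertex v _ => W u \in intro_vertex D v (W (lchild u))
     | IntroEdge e _ => W u \in intro_edge D e (W (lchild u))
     | ForgetVertex v _ => W u \in forget_vertex D v (W (lchild u))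
     | Join _ _ => W u \in join D (W (lchild u)) (W (rchild u))
     end) /\
  final D (W [::]).

Definition forgets (t : ntree) (u : node) (v : nat) : bool :=
  if subtree t u is ForgetVertex v' _ then v == v' else false.

(* In a nice tree decomposition of [G] every vertex is forgotten at exactly one
   node [u], so [has] tests the membership function at the child of that node. *)
Definition extracted (mu : nat -> bitstring -> bool) (G : sgraph) (t : ntree)
    (W : node -> bitstring) : {fset nat} :=
  [fset v in vertices G |
    has (fun u => forgets t u v && mu v (W (lchild u))) (nodes t)].

Definition solution_preserving (D : dp_core) (Pi : vertex_subset_problem) : Prop :=
  solves D Pi /\
  exists mu : nat -> bitstring -> bool,
    forall G t, nice_tree_decomposition G t ->
      (forall W, witness_tree D t W -> Pi G (extracted mu G t W)) /\
      (forall X, Pi G X -> exists2 W, witness_tree D t W & extracted mu G t W = X).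

Local Close Scope fset_scope.
Local Open Scope classical_set_scope.
Local Open Scope ring_scope.

(* alpha(k, n) = 2^(o(k / log k)) * n^(O(1)) *)
Definition two_pow_o_k_div_log_k_poly_n (R : realType)
    (alpha : nat -> nat -> nat) : Prop :=
  exists (f g : nat -> R) (c : nat),
    [/\ f =o_\oo (fun k : nat => k%:R / ln k%:R : R),
        g =O_\oo (fun n : nat => n%:R ^+ c : R)
      & forall k n : nat, (alpha k n)%:R <= 2 `^ f k * g n].

(* Main.v *)
(** If two witness trees of the same decomposition carry the same string at a
    node u, the part of one at and below u can be grafted onto the other; the
    extracted set then agrees with one of the two solutions on the vertices
    forgotten below u and with the other on the remaining vertices.  Take for
    the graph the matching {i, k + i}, i < k, with a path decomposition of
    width k which has a node u such that the vertices k + i are forgotten below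
    u and the vertices i above it.  For S a subset of {0, .., k - 1}, let X_S
    consist of the i in S and the k + i with i not in S, an independent set of
    size k.  Grafting a witness of X_T below u onto one of X_S gives an
    independent set only if S is a subset of T, so the witnesses of the 2 ^ k
    sets X_S (k >= l) carry distinct strings at u.  Hence
    alpha(k, 2k) >= 2 ^ k, which is not 2 ^ o(k / log k) * k ^ O(1). *)

Require Import Defs.
From mathcomp Require Import all_boot all_order all_algebra finmap zify.
From mathcomp Require Import boolp classical_sets reals ereal topology.
From mathcomp Require Import normedtype sequences landau exp.
Import numFieldNormedType.Exports.

Set Implicit Arguments.
Unset Strict Implicit.
Unset Printing Implicit Defensive.

Local Open Scope fset_scope.
Local Open Scope nat_scope.

(** * Witness trees *)

(** The local condition of [witness_tree], kept apart from finality of the root string, which does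
    not pass to subtrees. *)
Definition consistent_at D t (W : node -> bitstring) (u : node) : bool :=
  match subtree t u with
  | Leaf => W u \in leaf D
  | IntroVertex v _ => W u \in intro_vertex D v (W (lchild u))
  | IntroEdge e _ => W u \in intro_edge D e (W (lchild u))
  | ForgetVertex v _ => W u \in forget_vertex D v (W (lchild u))
  | Join _ _ => W u \in join D (W (lchild u)) (W (rchild u))
  end.

Lemma consistent_root_Gamma D t W :
  {in nodes t, forall u, consistent_at D t W u} -> W [::] \in Gamma D t.
Proof.
elim: t W => [|v t IH|e t IH|v t IH|t1 IH1 t2 IH2] W loc /=;
  have := loc [::] isT => //= Wroot.
1,2,3: apply/bigfcupP; exists (W [:: false]) => //; rewrite andbT;
  apply: (IH (fun x => W (false :: x))) => u tu; apply: (loc (false :: u));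
  by rewrite inE map_f.
apply/bigfcupP; exists (W [:: false]).
  rewrite andbT; apply: (IH1 (fun x => W (false :: x))) => u tu.
  by apply: (loc (false :: u)); rewrite inE mem_cat map_f.
apply/bigfcupP; exists (W [:: true]) => //.
rewrite andbT; apply: (IH2 (fun x => W (true :: x))) => u tu.
by apply: (loc (true :: u)); rewrite inE mem_cat map_f ?orbT.
Qed.

Lemma mem_map_cons (b c : bool) (u : node) s :
  (b :: u \in [seq c :: x | x <- s]) = (b == c) && (u \in s).
Proof.
apply/mapP/andP => [[x sx [-> ->]]|[/eqP -> su]]; first by [].
by exists u.
Qed.

Lemma nodes_subtree t u x : u \in nodes t -> x \in nodes (subtree t u) ->
  u ++ x \in nodes t.
Proof.
elim: t u => [|v t IH|e t IH|v t IH|t1 IH1 t2 IH2] [|[] u] //=;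
  rewrite !inE ?mem_cat ?mem_map_cons //= ?orbF.
- exact: IH.
- exact: IH.
- exact: IH.
- exact: IH2.
- exact: IH1.
Qed.

Lemma bag_at_root t : bag_at t [::] = bag t.
Proof. by case: t. Qed.

Lemma subtree_cat t u x :
  u \in nodes t -> subtree t (u ++ x) = subtree (subtree t u) x.
Proof.
elim: t u => [|v t IH|e t IH|v t IH|t1 IH1 t2 IH2] [|[] u] //=;
  rewrite !inE ?mem_cat ?mem_map_cons //= ?orbF.
- exact: IH.
- exact: IH.
- exact: IH.
- exact: IH2.
- exact: IH1.
Qed.

Lemma exists_node_subtree (P : ntree -> Prop) t w t' :
  w \in nodes t -> subtree t w = t' ->
  (exists2 u, u \in nodes t' & P (subtree t' u)) ->
  exists2 u, u \in nodes t & P (subtree t u).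
Proof.
move=> tw <- [u tu Pu]; exists (w ++ u); first exact: nodes_subtree.
by rewrite subtree_cat.
Qed.

(** Shifting [W] by [u] gives a consistent labelling of the subtree at [u]. Distinct strings of
    witness trees at [u] therefore count towards the table there. *)
Lemma witness_Gamma_at D t W u :
  witness_tree D t W -> u \in nodes t -> W u \in Gamma_at D t u.
Proof.
case=> loc _ tu; rewrite -[u in W u]cats0.
apply: (consistent_root_Gamma (W := fun x => W (u ++ x))) => x tx.
have := loc _ (nodes_subtree tu tx); rewrite subtree_cat // /consistent_at.
by rewrite /lchild /rchild /= -!rcons_cat.
Qed.

Lemma prefix_rconsE (T : eqType) (s r : seq T) x :
  prefix s (rcons r x) = (s == rcons r x) || prefix s r.
Proof.
elim: r s => [|y r IH] [|z s] //=; first by rewrite eqseq_cons orbF; case: s.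
by rewrite eqseq_cons IH -andb_orr.
Qed.

(** * Grafting one witness tree onto another *)

Definition swap_below (u : node) (W1 W2 : node -> bitstring) :
    node -> bitstring :=
  fun x => if prefix u x then W2 x else W1 x.

(** A child of a node outside the subtree at [u] is either outside as well or is [u] itself, where
    [W1] and [W2] agree. *)
Lemma swap_below_child u W1 W2 x b : W1 u = W2 u -> ~~ prefix u x ->
  swap_below u W1 W2 (rcons x b) = W1 (rcons x b).
Proof.
move=> Wu; rewrite /swap_below prefix_rconsE => /negbTE ->; rewrite orbF.
by case: eqP => [<-|].
Qed.

(** Each local condition involves only a node and its children. At and below [u] these all carry
    [W2]; elsewhere, agreement at [u] lets them all be read from [W1]. *)
Lemma witness_swap_below D t u W1 W2 : W1 u = W2 u ->
  witness_tree D t W1 -> witness_tree D t W2 ->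
  witness_tree D t (swap_below u W1 W2).
Proof.
move=> Wu [loc1 fin1] [loc2 fin2]; split; last first.
  by rewrite /swap_below; case: ifP.
move=> x tx; case: (boolP (prefix u x)) => ux.
  have WE b : swap_below u W1 W2 (rcons x b) = W2 (rcons x b).
    by rewrite /swap_below prefix_rconsE ux orbT.
  by have := loc2 x tx; rewrite /lchild /rchild !WE /swap_below ux.
have := loc1 x tx.
by rewrite /lchild /rchild !swap_below_child // /swap_below (negbTE ux).
Qed.

(** Membership of [v] is decided at the children of the nodes forgetting [v], and [b] tells on which
    side of [u] these nodes lie. A child is on the other side only if it is [u], where the
    labellings agree. *)
Lemma extracted_swap_below mu G t u W1 W2 v b : W1 u = W2 u ->
  {in nodes t, forall x, forgets t x v -> prefix u x = b} ->
  (v \in extracted mu G t (swap_below u W1 W2)) =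
  (v \in extracted mu G t (if b then W2 else W1)).
Proof.
move=> Wu uxb; rewrite !inE /=; congr (_ && _); apply: eq_in_has => x tx.
case fx: (forgets t x v) => //=; have := uxb x tx fx.
case: b {uxb} => ux; last by rewrite /lchild swap_below_child ?ux.
by rewrite /lchild /swap_below prefix_rconsE ux orbT.
Qed.

(** * Decompositions without join nodes *)

Fixpoint introduced_vertices (t : ntree) : seq nat :=
  match t with
  | Leaf => [::]
  | IntroVertex v t' => v :: introduced_vertices t'
  | IntroEdge _ t' | ForgetVertex _ t' => introduced_vertices t'
  | Join t1 t2 => introduced_vertices t1 ++ introduced_vertices t2
  end.

Fixpoint join_free (t : ntree) : bool :=
  match t with
  | Leaf => true
  | IntroVertex _ t' | IntroEdge _ t' | ForgetVertex _ t' => join_free t'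
  | Join _ _ => false
  end.

Lemma bag_introduced t : {subset bag t <= introduced_vertices t}.
Proof.
elim: t => [|v t IH|e t IH|v t IH|t1 IH1 t2 IH2] x //=; rewrite ?inE //.
- by case/orP=> [->//|/IH ->]; rewrite orbT.
- exact: IH.
- by case/andP=> _ /IH.
- by move=> /IH1; rewrite mem_cat => ->.
Qed.

(** Leaf bags are empty, so a vertex enters the bags only through an introduction node, whose own
    bag contains it. *)
Lemma mem_introduced_vertices t v :
  v \in introduced_vertices t <-> exists2 u, u \in nodes t & v \in bag_at t u.
Proof.
split; last first.
  case=> u tu.
  suff sub : {subset introduced_vertices (subtree t u)
                <= introduced_vertices t}.
    by move=> /bag_introduced/sub.
  elim: t u {tu} => [|w t IH|e t IH|w t IH|t1 IH1 t2 IH2] [|[] u] x //=.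
  - by move/IH; rewrite inE => ->; rewrite orbT.
  - exact: IH.
  - exact: IH.
  - by move/IH2; rewrite mem_cat => ->; rewrite orbT.
  - by move/IH1; rewrite mem_cat => ->.
have up := @exists_node_subtree (fun t' => v \in bag t').
elim: t => [|w t IH|e t IH|w t IH|t1 IH1 t2 IH2] //=.
- rewrite inE => /orP[/eqP ->|/IH].
    by exists [::]; rewrite // /bag_at /= !inE eqxx.
  by move=> h; refine (up (IntroVertex w t) [:: false] _ _ _ h); case: t {h IH}.
- by move/IH => h; refine (up (IntroEdge e t) [:: false] _ _ _ h);
    case: t {h IH}.
- by move/IH => h; refine (up (ForgetVertex w t) [:: false] _ _ _ h);
    case: t {h IH}.
- rewrite mem_cat => /orP[/IH1|/IH2].
    by move=> h; refine (up (Join t1 t2) [:: false] _ _ _ h); case: t1 {h IH1}.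
  move=> h; refine (up (Join t1 t2) [:: true] _ _ _ h).
  all: rewrite /= ?inE ?mem_cat ?mem_map_cons /= ?mem_map_cons.
  all: by case: t2 {h IH2}.
Qed.

Lemma introduced_edge_in_bag t e : nice t -> e \in introduced_edges t ->
  exists2 u, u \in nodes t & e `<=` bag_at t u.
Proof.
have up := @exists_node_subtree (fun t' => e `<=` bag t').
elim: t => [|w t IH|e' t IH|w t IH|t1 IH1 t2 IH2] //=.
- case/andP=> _ /IH{}IH /IH.
  by move=> h; refine (up (IntroVertex w t) [:: false] _ _ _ h); case: t {h IH}.
- case/andP=> et /IH{}IH; rewrite inE => /orP[/eqP ->|/IH].
    by exists [::].
  by move=> h; refine (up (IntroEdge e' t) [:: false] _ _ _ h);
    case: t {h IH et}.
- case/andP=> _ /IH{}IH /IH.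
  by move=> h; refine (up (ForgetVertex w t) [:: false] _ _ _ h);
    case: t {h IH}.
- case/and3P=> _ /IH1{}IH1 /IH2{}IH2; rewrite mem_cat => /orP[/IH1|/IH2].
    by move=> h; refine (up (Join t1 t2) [:: false] _ _ _ h); case: t1 {h IH1}.
  move=> h; refine (up (Join t1 t2) [:: true] _ _ _ h).
  all: rewrite /= ?inE ?mem_cat ?mem_map_cons /= ?mem_map_cons.
  all: by case: t2 {h IH2}.
Qed.

(** The connectivity clause of [tree_decomposition] for a single vertex, isolated for induction on
    the tree. *)
Definition occurrences_connected (t : ntree) (v : nat) : Prop :=
  forall u w,
    u \in nodes t -> w \in nodes t -> v \in bag_at t u -> v \in bag_at t w ->
    exists p : seq node,
      [/\ path tree_adj u p, last u p = w
        & forall x, x \in p -> x \in nodes t /\ v \in bag_at t x].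

(** The two equations treat the three kinds of unary nodes at once. Paths in [t'] lift by prepending
    [false]. A path between the root of [t] and a lower node goes through the root of [t'], whose
    bag contains [v] unless [v] is new at the root of [t]. *)
Lemma occurrences_connected_child t t' v :
    nodes t = [::] :: [seq false :: x | x <- nodes t'] ->
    (forall x, subtree t (false :: x) = subtree t' x) ->
    (v \in bag t -> v \in bag t' \/
       forall x, x \in nodes t' -> v \notin bag_at t' x) ->
  occurrences_connected t' v -> occurrences_connected t v.
Proof.
move=> tE subE root conn.
have nmem (x : node) : (false :: x \in nodes t) = (x \in nodes t').
  by rewrite tE inE mem_map // => ? ? [].
have bagE x : bag_at t (false :: x) = bag_at t' x by rewrite /bag_at subE.
have adj (x y : node) : tree_adj (false :: x) (false :: y) = tree_adj x y by [].
have lift (u w : node) (p : seq node) : path tree_adj u p -> last u p = w ->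
    (forall x, x \in p -> x \in nodes t' /\ v \in bag_at t' x) ->
    [/\ path tree_adj (false :: u) [seq false :: x | x <- p],
       last (false :: u) [seq false :: x | x <- p] = false :: w &
       forall x, x \in [seq false :: x | x <- p] ->
         x \in nodes t /\ v \in bag_at t x].
  move=> up ul pin; split.
  - by rewrite path_map (eq_path (e' := tree_adj)) // => x y; exact: adj.
  - by rewrite last_map ul.
  - by move=> _ /mapP[x /pin[? ?] ->]; rewrite nmem bagE.
have tfalse (b : bool) (x : node) :
    b :: x \in nodes t -> b = false /\ x \in nodes t'.
  by rewrite tE inE /= => /mapP[y ty [-> ->]].
have root' : [::] \in nodes t' by case: (t').
move=> [|bu u] [|bw w].
- by exists [::].
- move=> _ /tfalse[-> tw]; rewrite bag_at_root bagE => vt vw.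
  case: (root vt) => [vt'|/(_ w tw)]; last by rewrite vw.
  rewrite -bag_at_root in vt'.
  have [p [pp pl pin]] := conn [::] w root' tw vt' vw.
  have [qp ql qin] := lift _ _ _ pp pl pin.
  exists ([:: false] :: [seq false :: x | x <- p]); split=> // x.
  by rewrite inE => /orP[/eqP ->|/qin //]; rewrite nmem bagE.
- move=> /tfalse[-> tu] _; rewrite bag_at_root bagE => vu vt.
  case: (root vt) => [vt'|/(_ u tu)]; last by rewrite vu.
  rewrite -bag_at_root in vt'.
  have [p [pp pl pin]] := conn u [::] tu root' vu vt'.
  have [qp ql qin] := lift _ _ _ pp pl pin.
  exists (rcons [seq false :: x | x <- p] [::]); split.
  + by rewrite rcons_path qp ql.
  + by rewrite last_rcons.
  + move=> x; rewrite mem_rcons inE => /orP[/eqP ->|/qin //].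
    by rewrite tE mem_head bag_at_root.
- move=> /tfalse[-> tu] /tfalse[-> tw]; rewrite !bagE => vu vw.
  have [p [pp pl pin]] := conn u w tu tw vu vw.
  by exists [seq false :: x | x <- p]; apply: lift.
Qed.

(** Uniqueness keeps a vertex introduced at the root out of every bag below, so no vertex comes back
    after having been forgotten. *)
Lemma join_free_occurrences_connected t v :
  join_free t -> uniq (introduced_vertices t) -> occurrences_connected t v.
Proof.
elim: t => [|w t IH|e t IH|w t IH|//] /=.
- by move=> _ _ u u'; rewrite !inE => /eqP -> _; rewrite /bag_at inE.
- move=> jt /andP[wt ut]; apply: occurrences_connected_child (IH jt ut) => //=.
  rewrite !inE => /orP[/eqP ->|]; [right|by left].
  move=> x tx; apply: contra wt => wx.
  by apply/mem_introduced_vertices; exists x.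
- move=> jt ut; apply: occurrences_connected_child (IH jt ut) => //=.
  by left.
- move=> jt ut; apply: occurrences_connected_child (IH jt ut) => //=.
  by rewrite !inE => /andP[]; left.
Qed.

(** Reduces the path and existence conditions of a decomposition to computations on the lists of
    introduced vertices and edges. *)
Lemma join_free_nice_tree_decomposition G t :
    join_free t -> nice t -> bag t = fset0 ->
    uniq (introduced_vertices t) -> uniq (introduced_edges t) ->
    vertices G =i introduced_vertices t -> edges G =i introduced_edges t ->
  nice_tree_decomposition G t.
Proof.
move=> jt nt bt uv ue vG eG; split=> //; last first.
  by move=> e; rewrite count_uniq_mem // eG.
split; first by move=> v; rewrite vG; exact: mem_introduced_vertices.
  by move=> e; rewrite eG; exact: introduced_edge_in_bag.
by move=> v; exact: join_free_occurrences_connected.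
Qed.

(** * A path decomposition of the matching {i, k + i}, i < k *)

Fixpoint intro_below (j : nat) : ntree :=
  if j is j'.+1 then IntroVertex j' (intro_below j') else Leaf.

Definition matching_edge (k i : nat) : {fset nat} := [fset i; k + i].

(** The high vertices [k + i] are handled one at a time on top of the bag of all low vertices, each
    forgotten before the next is introduced; this keeps the width at most [k]. *)
Fixpoint match_below (k j : nat) : ntree :=
  if j is j'.+1 then
    ForgetVertex (k + j') (IntroEdge (matching_edge k j')
      (IntroVertex (k + j') (match_below k j')))
  else intro_below k.

(** Low vertices are forgotten only after all high ones, so the root of [match_below k k] separates
    the two kinds of forget nodes. *)
Fixpoint forget_below (k j : nat) : ntree :=
  if j is j'.+1 then ForgetVertex j' (forget_below k j') else match_below k k.

Definition matching_decomposition (k : nat) : ntree := forget_below k k.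

Lemma bag_intro_below j v : (v \in bag (intro_below j)) = (v < j).
Proof. by elim: j => //= j IH; rewrite !inE IH; lia. Qed.

Lemma bag_match_below k j : bag (match_below k j) = bag (intro_below k).
Proof.
elim: j => //= j ->; apply/fsetP => v; rewrite !inE bag_intro_below.
by case: eqP => //= ->; rewrite ltnNge leq_addr.
Qed.

Lemma bag_forget_below k j v : (v \in bag (forget_below k j)) = (j <= v < k).
Proof.
elim: j => [|j IH] /=; first by rewrite bag_match_below bag_intro_below.
by rewrite !inE IH; lia.
Qed.

Lemma card_bag_intro_below j : #|` bag (intro_below j)| = j.
Proof.
elim: j => [|j IH] //=.
by rewrite cardfsU1 bag_intro_below ltnn IH.
Qed.

Lemma nice_matching_decomposition k : nice (matching_decomposition k).
Proof.
have nI j : nice (intro_below j).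
  by elim: j => //= j ->; rewrite bag_intro_below ltnn.
have nM j : j <= k -> nice (match_below k j).
  elim: j => //= j IH jk; rewrite IH 1?ltnW // andbT !inE eqxx /=.
  rewrite bag_match_below bag_intro_below ltnNge leq_addr /= andbT.
  apply/fsubsetP => x; rewrite !inE bag_intro_below => /orP[]/eqP->.
    by rewrite jk orbT.
  by rewrite eqxx.
have nF j : j <= k -> nice (forget_below k j).
  elim: j => [|j IH] jk /=; first exact: nM.
  by rewrite bag_forget_below leqnn jk IH // ltnW.
exact: nF.
Qed.

Lemma introduced_vertices_matching k :
  introduced_vertices (matching_decomposition k) = rev (iota 0 (k + k)).
Proof.
have vI j : introduced_vertices (intro_below j) = rev (iota 0 j).
  by elim: j => // j IH; rewrite [LHS]/= IH -[j.+1]addn1 iotaD rev_cat.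
have vM j : introduced_vertices (match_below k j) = rev (iota 0 (k + j)).
  elim: j => [|j IH]; first by rewrite addn0 vI.
  by rewrite [LHS]/= IH addnS -[(k + j).+1]addn1 (iotaD _ (k + j) 1) rev_cat.
have vF j : introduced_vertices (forget_below k j) = rev (iota 0 (k + k)).
  by elim: j => //; exact: vM.
exact: vF.
Qed.

Lemma introduced_edges_matching k :
  introduced_edges (matching_decomposition k) =
  rev [seq matching_edge k i | i <- iota 0 k].
Proof.
have vI j : introduced_edges (intro_below j) = [::] by elim: j.
have vM j : introduced_edges (match_below k j) =
            rev [seq matching_edge k i | i <- iota 0 j].
  elim: j => [|j IH]; first exact: vI.
  by rewrite [LHS]/= IH -[j.+1]addn1 iotaD map_cat rev_cat.
have vF j : introduced_edges (forget_below k j) =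
            rev [seq matching_edge k i | i <- iota 0 k].
  by elim: j => //; exact: vM.
exact: vF.
Qed.

Lemma matching_edge_inj k : {in gtn k &, injective (matching_edge k)}.
Proof.
move=> i j; rewrite !inE => ik jk /fsetP/(_ i).
by rewrite !inE eqxx => /esym/orP[]/eqP //; lia.
Qed.

Lemma matching_edgesP k e :
  e \in [fset matching_edge k i | i in iota 0 k] ->
  (e `<=` [fset v in iota 0 (k + k)]) && (#|` e| == 2).
Proof.
case/imfsetP => i /=; rewrite mem_iota => ik ->; apply/andP; split.
  by apply/fsubsetP => x; rewrite !inE mem_iota => /orP[]/eqP ->; lia.
(* The two ends differ because [i < k] forces [k] to be positive. *)
by rewrite cardfs2; apply/eqP; congr S; case: eqP => //; lia.
Qed.

Definition matching (k : nat) : sgraph := SGraph (@matching_edgesP k).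

Lemma matching_nice_tree_decomposition k :
  nice_tree_decomposition (matching k) (matching_decomposition k).
Proof.
apply: join_free_nice_tree_decomposition.
- have jI j : join_free (intro_below j) by elim: j.
  have jM j : join_free (match_below k j) by elim: j => //=.
  have jF j : join_free (forget_below k j) by elim: j => //=.
  exact: jF.
- exact: nice_matching_decomposition.
- apply/fsetP => v; rewrite bag_forget_below inE; lia.
- by rewrite introduced_vertices_matching rev_uniq iota_uniq.
- rewrite introduced_edges_matching rev_uniq map_inj_in_uniq ?iota_uniq //.
  by move=> i j; rewrite !mem_iota; exact: matching_edge_inj.
- by move=> v; rewrite introduced_vertices_matching mem_rev !inE.
- move=> e; rewrite introduced_edges_matching mem_rev.
  by apply/imfsetP/mapP.
Qed.

Lemma card_matching k : #|` vertices (matching k)| = k + k.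
Proof. by rewrite card_fseq undup_id ?iota_uniq // size_iota. Qed.

Lemma width_matching_decomposition k : width (matching_decomposition k) <= k.
Proof.
pose mb t := \max_(u <- nodes t) #|` bag_at t u|.
suff : mb (matching_decomposition k) <= k.+1 by rewrite /width /mb; lia.
(* Every inner node is unary, so the maximum can be peeled off one root at a time. The largest bags
   hold the [k] low vertices and one high vertex. *)
have mbE t t' : nodes t = [::] :: [seq false :: x | x <- nodes t'] ->
    (forall x, subtree t (false :: x) = subtree t' x) ->
    mb t = maxn #|` bag t| (mb t').
  move=> tE sE; rewrite /mb tE big_cons big_map bag_at_root; congr maxn.
  by apply: eq_bigr => x _; rewrite /bag_at sE.
have mI j : mb (intro_below j) <= j.
  elim: j => [|j IH]; first by rewrite /mb /= big_seq1 cardfs0.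
  by rewrite (mbE _ (intro_below j)) // geq_max card_bag_intro_below; lia.
have cM := card_bag_intro_below k.
have mM j : mb (match_below k j) <= k.+1.
  elim: j => [|j IH]; first exact: leq_trans (mI k) _.
  have c1 : #|` (k + j) |` bag (match_below k j)| <= k.+1.
    by rewrite cardfsU1 bag_match_below cM; case: (_ \notin _).
  rewrite (mbE _ (IntroEdge (matching_edge k j)
      (IntroVertex (k + j) (match_below k j)))) // geq_max bag_match_below cM.
  rewrite leqnSn (mbE _ (IntroVertex (k + j) (match_below k j))) // geq_max c1.
  by rewrite (mbE _ (match_below k j)) // geq_max c1.
have mF j : mb (forget_below k j) <= k.+1.
  elim: j => [|j IH]; first exact: mM.
  rewrite (mbE _ (forget_below k j)) // geq_max IH andbT.
  rewrite (leq_trans _ (leqnSn k)) // -{2}cM; apply: fsubset_leq_card.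
  by apply/fsubsetP => v; rewrite bag_forget_below bag_intro_below => /andP[].
exact: mF.
Qed.

(** From the root, [k] steps pass the forget nodes of all low vertices and end at the root of
    [match_below k k]. *)
Definition cut_node (k : nat) : node := nseq k false.

Lemma cut_node_in k : cut_node k \in nodes (matching_decomposition k).
Proof.
(* Only the depth is generalised; the size of the matching stays [k]. *)
rewrite /matching_decomposition /cut_node; move: {1 3}k => j.
elim: j => [|j IH] /=; first by case: (match_below k k).
by rewrite inE mem_map_cons eqxx.
Qed.

(** Supplies the side condition of [extracted_swap_below] at the cut, with [b] equal to [k <= v]. *)
Lemma prefix_cut_node k x v :
  x \in nodes (matching_decomposition k) ->
  forgets (matching_decomposition k) x v -> prefix (cut_node k) x = (k <= v).
Proof.
have fI j y : ~~ forgets (intro_below j) y v.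
  by elim: j y => [|j IH] [|[] y] //=; exact: IH.
have fM j y : forgets (match_below k j) y v -> k <= v.
  elim: j y => [|j IH] y; first by rewrite (negbTE (fI _ _)).
  (* A round of [match_below] consists of three unary nodes, of which only the top one forgets a
     vertex; below them the induction hypothesis applies. *)
  case: y => [|[] [|[] [|[] y]]] //; last exact: IH.
  by rewrite /forgets /= => /eqP ->; exact: leq_addr.
have fF j y : j <= k -> y \in nodes (forget_below k j) ->
    forgets (forget_below k j) y v -> prefix (cut_node j) y = (k <= v).
  elim: j y => [|j IH] y jk; first by rewrite prefix0s => _ /fM ->.
  case: y => [|[] y] //=.
    by move=> _; rewrite /forgets /= => /eqP ->; rewrite leqNgt jk.
  by rewrite inE mem_map_cons eqxx => /= ty; apply: IH => //; exact: ltnW.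
exact: fF.
Qed.

(** * Independent sets with one end of each matching edge *)

Definition transversal (k : nat) (S : {fset nat}) : {fset nat} :=
  S `|` [fset k + i | i in [fset v in iota 0 k] `\` S].

Lemma transversal_low k S i : i < k -> (i \in transversal k S) = (i \in S).
Proof.
move=> ik; rewrite in_fsetU; case: (i \in S) => //=.
by apply/negbTE/negP => /imfsetP[j _ ij]; lia.
Qed.

Lemma transversal_high k S i : S `<=` [fset v in iota 0 k] -> i < k ->
  (k + i \in transversal k S) = (i \notin S).
Proof.
move=> Sk ik; rewrite in_fsetU.
have /negbTE -> : k + i \notin S.
  apply/negP => /(fsubsetP Sk); rewrite !inE mem_iota; lia.
apply/imfsetP/idP => /= [[j + /addnI ->]|iS]; first by rewrite !inE => /andP[].
by exists i => //; rewrite !inE mem_iota iS.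
Qed.

Lemma card_transversal k S : S `<=` [fset v in iota 0 k] ->
  #|` transversal k S| = k.
Proof.
move=> Sk.
(* The union bound on cardinals is an equality exactly for disjoint sets, and here low vertices are
   joined with high ones. *)
have := leq_card_fsetU S [fset k + i | i in [fset v in iota 0 k] `\` S].
rewrite /transversal; case=> _.
set T := imfset _ _ _; have -> : [disjoint S & T]%fset.
  apply/fdisjointP => i /(fsubsetP Sk); rewrite !inE mem_iota => ik.
  by apply/negP => /imfsetP[j _ ij]; lia.
move=> /eqP ->; rewrite card_imfset /=; last by move=> x y /addnI.
rewrite cardfsDS // card_fseq undup_id ?iota_uniq // size_iota.
rewrite subnKC //; have := fsubset_leq_card Sk.
by rewrite card_fseq undup_id ?iota_uniq // size_iota.
Qed.

Lemma independent_transversal k S : S `<=` [fset v in iota 0 k] ->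
  independent (matching k) (transversal k S).
Proof.
move=> Sk; split.
  apply/fsubsetP => v; rewrite in_fsetU !inE mem_iota.
  case/orP => [/(fsubsetP Sk)|/imfsetP[i + ->]]; rewrite !inE ?mem_iota; lia.
move=> u v uX vX; apply/negP => /imfsetP[i]; rewrite /= mem_iota => ik uvE.
(* Both ends of the edge of index [i] would be chosen, so [i] would lie both in [S] and outside
   it. *)
have sub x : x \in matching_edge k i -> x \in transversal k S.
  by rewrite -uvE in_fset2 => /orP[]/eqP ->.
have := sub i; have := sub (k + i).
rewrite transversal_high // transversal_low // !in_fset2 !eqxx orbT /=.
by move=> /(_ isT) /negP iS /(_ isT).
Qed.

(** * The exponential lower bound on tables *)

Lemma solution_preserving_exponential l D alpha k : l <= k ->
  solution_preserving D (IndependentSet l) -> table_complexity D alpha ->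
  2 ^ k <= alpha k (k + k).
Proof.
move=> lk [_ [mu presD]] tabD.
have td := matching_nice_tree_decomposition k.
have := tabD k _ _ _ (card_matching k) td (width_matching_decomposition k) _
  (cut_node_in k).
apply: leq_trans; have [sound complete] := presD _ _ td.
set B := [fset v in iota 0 k].
(* The inclusion stands under the existential so that [choice] applies to all [S]; sets that are not
   included in [B] get a dummy labelling. *)
have wit S : exists W, S `<=` B ->
    witness_tree D (matching_decomposition k) W /\
    extracted mu (matching k) (matching_decomposition k) W = transversal k S.
  have [SB|] := boolP (S `<=` B); last by exists (fun=> [::]).
  have [|W WD WE] := complete (transversal k S); last by exists W.
  by split; [exact: independent_transversal | rewrite card_transversal].
have [W WP] := choice wit.
have below S T : S `<=` B -> T `<=` B -> W S (cut_node k) = W T (cut_node k) ->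
    S `<=` T.
  move=> SB TB WST; have [wS eS] := WP S SB; have [wT eT] := WP T TB.
  have [[_ ind] _] := sound _ (witness_swap_below WST wS wT).
  apply/fsubsetP => i iS; apply/negPn/negP => iT.
  have ik : i < k by have := fsubsetP SB i iS; rewrite !inE mem_iota.
  (* The graft extracts the low vertices of [transversal k S] and the high ones of
     [transversal k T]. An [i] in [S] but not in [T] would put both [i] and [k + i] into the
     extracted set. *)
  have swapE v := extracted_swap_below mu (matching k) WST
    (fun x tx => @prefix_cut_node k x v tx).
  have iY := swapE i; rewrite leqNgt ik /= eS transversal_low // iS in iY.
  have kiY := swapE (k + i); rewrite leq_addr eT transversal_high // iT in kiY.
  have /negP := ind _ _ iY kiY; apply.
  by apply/imfsetP; exists i => //=; rewrite mem_iota.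
have cB : #|` fpowerset B| = 2 ^ k.
  by rewrite card_fpowerset card_fseq undup_id ?iota_uniq // size_iota.
(* Using [below] in both directions, the string at the cut determines [S]. *)
have <- : #|` [fset W S (cut_node k) | S in fpowerset B]| = 2 ^ k.
  rewrite card_in_imfset //= => S T; rewrite !fpowersetE => SB TB WST.
  by apply/eqP; rewrite eqEfsubset; apply/andP; split; apply: below.
apply/fsubset_leq_card/fsubsetP => _ /imfsetP[S /= + ->].
rewrite fpowersetE => /WP[wS _].
by apply: witness_Gamma_at wS _; exact: cut_node_in.
Qed.

(** * Growth *)

Import Order.TTheory GRing.Theory Num.Theory.
Local Open Scope classical_set_scope.
Local Open Scope ring_scope.

(** Written as an exponential, the power of 2 dominates a single term of its series, taken of degree
    [c.+1], one more than that of the monomial. *)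
Lemma near_monomial_lt_pow2 (R : realType) (C : R) (c : nat) :
  \forall m \near \oo, C * m%:R ^+ c < 2 ^+ m.
Proof.
have ln2 : 0 < ln 2 :> R by rewrite ln_gt0 // ltr1n.
(* The value of [m] from which the series term of degree [c.+1] in [ln 2 * m] reaches
   [|C| * m ^ c]. *)
pose K := `|C| * c.+1`!%:R / ln 2 ^+ c.+1.
near=> m.
have Km : K < m%:R.
  apply: lt_le_trans (truncnS_gt K) _; rewrite ler_nat.
  by near: m; exact: nbhs_infty_ge.
have fact0 : 0 < c.+1`!%:R :> R by rewrite ltr0n fact_gt0.
have m0 : 0 <= m%:R :> R by [].
apply: (@le_lt_trans _ _ ((ln 2 * m%:R) ^+ c.+1 / c.+1`!%:R)).
  rewrite ler_pdivlMr // exprMn [m%:R ^+ c.+1]exprS mulrA [leLHS]mulrAC.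
  rewrite ler_wpM2r ?exprn_ge0 // (le_trans _ (y := `|C| * c.+1`!%:R)) //.
    by rewrite ler_wpM2r ?ler_norm // ltW.
  by rewrite [leRHS]mulrC -ler_pdivrMr ?exprn_gt0 // ltW.
have -> : 2 ^+ m = expR (ln 2 * m%:R) :> R.
  by rewrite expRM lnK ?posrE // powR_mulrn.
have x0 : 0 <= ln 2 * m%:R :> R by rewrite mulr_ge0 // ltW.
(* The constant term 1 of the series makes the inequality strict. *)
by apply: lt_le_trans (expR_ge1Dxn c x0); rewrite ltrDr.
Unshelve. all: by end_near. Qed.

Lemma exponential_not_subexponential (R : realType) alpha (l : nat) :
  (forall k, (l <= k)%N -> (2 ^ k <= alpha k (k + k))%N) ->
  ~ two_pow_o_k_div_log_k_poly_n R alpha.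
Proof.
move=> lower [f [g [c [fo gO bound]]]].
have ln2 : 0 < ln 2 :> R by rewrite ln_gt0 // ltr1n.
(* With this constant, [f (2m)] is at most [m * ln 2 / ln (2m)], hence at most [m]. *)
have [K1 _ hf] := (eqoP _ _ _).1 fo (ln 2 / 2) (divr_gt0 ln2 (ltr0Sn _ 1)).
have [C C0 [K2 _ hg]] := (eqO_exP _ _ _).1 gO.
(* The bounds are compared at [k = 2m] and [n = 4m]; the factor [4 ^ c] comes from this [n]. *)
have [K3 _ hexp] := near_monomial_lt_pow2 (C * 4 ^+ c) c.
(* Beyond all thresholds and [l], and positive so that [ln (2m)] is at least [ln 2]. Of the lower
   bound [2 ^ (2m)], one factor [2 ^ m] absorbs the power with exponent [f] and the other exceeds
   the polynomial. *)
pose m := (K1 + K2 + K3 + l).+1.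
have fm : f (m + m)%N <= m%:R.
  apply: le_trans (ler_norm _) _; apply: le_trans (hf (m + m)%N _) _.
    by rewrite /m /=; lia.
  have lnm : ln 2 <= ln (m + m)%:R :> R.
    by rewrite ler_ln ?posrE ?ltr0n ?ler_nat; rewrite /m; lia.
  have lnm0 := lt_le_trans ln2 lnm.
  have q0 : 0 <= (m + m)%:R / ln (m + m)%:R :> R by rewrite divr_ge0 // ltW.
  rewrite ger0_norm // mulrA ler_pdivrMr //.
  have -> : ln 2 / 2 * (m + m)%:R = m%:R * ln 2 :> R.
    by rewrite addnn -muln2 natrM mulrC -mulrA [2 * _]mulrC divfK.
  by rewrite ler_wpM2l.
have gm : g (m + m + (m + m))%N <= C * 4 ^+ c * m%:R ^+ c.
  apply: le_trans (ler_norm _) _; apply: le_trans (hg _ _) _.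
    by rewrite /m /=; lia.
  rewrite normrX normr_nat -mulrA -exprMn -natrM.
  by have -> : (m + m + (m + m) = 4 * m)%N by lia.
have m3 : C * 4 ^+ c * m%:R ^+ c < 2 ^+ m by apply: hexp; rewrite /m /=; lia.
have low : (2 ^ (m + m))%:R <= 2 `^ f (m + m)%N * g (m + m + (m + m))%N :> R.
  apply: le_trans (bound _ _); rewrite ler_nat; apply: lower.
  by rewrite /m; lia.
have := le_trans low (ler_wpM2l (powR_ge0 _ _) gm).
apply/negP; rewrite -ltNge natrX exprD.
apply: (@le_lt_trans _ _ (2 ^+ m * (C * 4 ^+ c * m%:R ^+ c))).
  rewrite ler_wpM2r //.
    by rewrite !mulr_ge0 ?exprn_ge0 // ltW.
  by rewrite -powR_mulrn // ler_powR // ler1n.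
by rewrite ltr_pM2l // exprn_gt0.
Qed.

Theorem theorem7p2 (R : realType) (l : nat) :
  ~ exists (D : dp_core) (alpha : nat -> nat -> nat),
      [/\ solution_preserving D (IndependentSet l),
          table_complexity D alpha
        & two_pow_o_k_div_log_k_poly_n R alpha].
Proof.
case=> D [alpha [presD tabD]]; apply: (@exponential_not_subexponential R _ l).
by move=> k lk; exact: solution_preserving_exponential presD tabD.
Qed.
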